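(* Let $a \in (0,1)$ and define $$\mathcal{N}(a) = \frac{20800}{a^7(1-a)^4}.$$ Let $n$ be an integer with $n \geq \mathcal{N}(a)$, and let $P(z) = (z-a)\prod_{j=1}^{n-1}(z-z_j)$ be a polynomial with $z_1,\dots,z_{n-1}\in\mathbb{C}$ and $|z_j|\leq 1$ for all $j = 1, \ldots , n-1$. Then the closed disk $\{z\in\mathbb{C} : |z-a|\leq 1\}$ contains a critical point of $P$ (i.e. a zero of $P'$). *)

(* Defs.v *)
From HB Require Import structures.
From mathcomp Require Import all_boot all_order all_algebra.
Set Implicit Arguments. Unset Strict Implicit. Unset Printing Implicit Defensive.
Import Order.TTheory GRing.Theory Num.Theory.
Local Open Scope ring_scope.

Definition calN (C : numClosedFieldType) (a : C) : C :=
  20800%:R / (a ^+ 7 * (1 - a) ^+ 4).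

Definition sendovP (C : numClosedFieldType) (a : C) (n : nat)
  (z : 'I_n.-1 -> C) : {poly C} :=
  ('X - a%:P) * \prod_(j < n.-1) ('X - (z j)%:P).

(* Main.v *)
Require Import Defs.
From HB Require Import structures.
From mathcomp Require Import all_boot all_order all_algebra.
From mathcomp Require Import ring lra.
Import Order.TTheory GRing.Theory Num.Theory.
Local Open Scope ring_scope.
Set Implicit Arguments. Unset Strict Implicit. Unset Printing Implicit Defensive.

(** Suppose that every critical point [g] of [P = (z - a) p] satisfies [|g - a| > 1].
By Gauss-Lucas, [g] lies in the lune [|g| <= 1 < |g - a|], on which
[Re (1 / (a - g)) >= a / 2].  The Grace-Walsh-Szego coincidence theorem, applied to the
functional "integral of [P'] between two points", evaluates [p] exactly:
[p c = (P' a / n) (1 + u + ... + u^(n-1))] where [|u| < 1] is the ratio of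
distances from some point of an Apollonius disk containing all [g] to [c] and to [a].
With [L := |P' a / n| >= 1], this has four consequences.
- [|p c| >= L / 4] for real [c] in [0, a] not too close to the endpoints; taking
  [c] of order [1 / (n a)] shows that the product of the [1 / |z_j|] (cut off at
  [|z_j| = 1/2]) is bounded independently of [n].
- [p] has no zero near [c1 = a - e / 2], and [|p c1|] is at most a constant times [L].
- [|p (a + e)| >= (L / 4) (1 + e a)^((n - 1) / 2)] grows exponentially in [n].
- [|p (a - 2 e)| >= L / 4].
Compare with [q x = prod (1 - z_j^* x)], which dominates [|p|] on [0, 1].  The points
[a - 2 e], [c1], [a + e] are in arithmetic progression and [log |q|] is harmonic in the
unit disk, so [|q (a + e) q (a - 2 e)| <= |q c1|^2 (1 + O(e^2 / (1 - a)^2))^n], while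
the first two consequences bound [|q c1| / L] independently of [n].  For
[e = a (1 - a)^2 / 9] and [n] large this contradicts the exponential growth. *)

(** * Real elements of a closed numeric field *)

(** [C] is only partially ordered; its real elements form an ordered field, on which [lra] and [nra]
    can work. *)
Definition creal (C : numClosedFieldType) := {x : C | x \is Num.real}.

Section RealSubfield.
Variable C : numClosedFieldType.
Local Notation R := (creal C).

HB.instance Definition _ := SubChoice.on R.
HB.instance Definition _ := [SubChoice_isSubIntegralDomain of R by <:].
HB.instance Definition _ := [SubIntegralDomain_isSubField of R by <:].

Let rle (x y : R) := val x <= val y.
Let rlt (x y : R) := val x < val y.
Let rnorm (x : R) : R := Sub `|val x| (normr_real (val x)).

Fact rle0_add x y : rle 0 x -> rle 0 y -> rle 0 (x + y).
Proof. exact: addr_ge0. Qed.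
Fact rle0_mul x y : rle 0 x -> rle 0 y -> rle 0 (x * y).
Proof. exact: mulr_ge0. Qed.
Fact rle0_anti x : rle 0 x -> rle x 0 -> x = 0.
Proof. by move=> x0 x0'; apply/val_inj/le_anti/andP. Qed.
Fact rsub_ge0 x y : rle 0 (y - x) = rle x y.
Proof. exact: subr_ge0. Qed.
Fact rle0_total x : rle 0 x || rle x 0.
Proof. by have := valP x; rewrite realE. Qed.
Fact rnormN x : rnorm (- x) = rnorm x.
Proof. by apply/val_inj; exact: normrN. Qed.
Fact rge0_norm x : rle 0 x -> rnorm x = x.
Proof. by move=> x0; apply/val_inj; exact: ger0_norm. Qed.
Fact rlt_def x y : rlt x y = (y != x) && rle x y.
Proof. exact: lt_def. Qed.

HB.instance Definition _ := Num.IntegralDomain_isLeReal.Build R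
  rle0_add rle0_mul rle0_anti rsub_ge0 rle0_total rnormN rge0_norm rlt_def.

Definition rval : R -> C := val.
HB.instance Definition _ := GRing.RMorphism.on rval.

Lemma ler_rval : {mono rval : x y / x <= y}. Proof. by []. Qed.
Lemma rval_inj : injective rval. Proof. exact: val_inj. Qed.

Definition re (x : C) : R := Sub ('Re x) (Creal_Re x).
Definition im (x : C) : R := Sub ('Im x) (Creal_Im x).
Definition nrm (x : C) : R := Sub `|x| (normr_real x).
(** The squared modulus is written in coordinates so that, after rewriting with [coordE], its
    identities are polynomial ones. *)
Definition sq (x : C) : R := re x ^+ 2 + im x ^+ 2.


Lemma rval_re x : rval (re x) = 'Re x. Proof. by []. Qed.
Lemma rval_im x : rval (im x) = 'Im x. Proof. by []. Qed.
Lemma rval_nrm x : rval (nrm x) = `|x|. Proof. by []. Qed.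

Lemma reD x y : re (x + y) = re x + re y.
Proof. by apply: rval_inj; rewrite rmorphD /= !rval_re raddfD. Qed.
Lemma imD x y : im (x + y) = im x + im y.
Proof. by apply: rval_inj; rewrite rmorphD /= !rval_im raddfD. Qed.
Lemma reN x : re (- x) = - re x.
Proof. by apply: rval_inj; rewrite rmorphN /= !rval_re raddfN. Qed.
Lemma imN x : im (- x) = - im x.
Proof. by apply: rval_inj; rewrite rmorphN /= !rval_im raddfN. Qed.
Lemma reM x y : re (x * y) = re x * re y - im x * im y.
Proof.
by apply: rval_inj; rewrite rmorphB !rmorphM /= !(rval_re, rval_im) ReM.
Qed.
Lemma imM x y : im (x * y) = re x * im y + re y * im x.
Proof.
by apply: rval_inj; rewrite rmorphD !rmorphM /= !(rval_re, rval_im) ImM.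
Qed.
Lemma re_conj x : re x^* = re x.
Proof. by apply: rval_inj; rewrite rval_re Re_conj. Qed.
Lemma im_conj x : im x^* = - im x.
Proof. by apply: rval_inj; rewrite rmorphN /= !rval_im Im_conj. Qed.
Lemma re_rval x : re (rval x) = x.
Proof. by apply: rval_inj; rewrite rval_re; apply/Creal_ReP/(valP x). Qed.
Lemma im_rval x : im (rval x) = 0.
Proof. by apply: rval_inj; rewrite rval_im rmorph0; apply/Creal_ImP/(valP x). Qed.
Lemma re1 : re 1 = 1. Proof. by rewrite -(rmorph1 rval) re_rval. Qed.
Lemma im1 : im 1 = 0. Proof. by rewrite -(rmorph1 rval) im_rval. Qed.
Lemma re0 : re 0 = 0. Proof. by rewrite -(rmorph0 rval) re_rval. Qed.
Lemma im0 : im 0 = 0. Proof. by rewrite -(rmorph0 rval) im_rval. Qed.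

Definition coordE := (reD, imD, reN, imN, reM, imM, re_conj, im_conj,
  re_rval, im_rval, re1, im1, re0, im0).

Lemma nrm_ge0 x : 0 <= nrm x. Proof. by rewrite -ler_rval rmorph0; exact: normr_ge0. Qed.
Lemma nrmM x y : nrm (x * y) = nrm x * nrm y.
Proof. by apply: rval_inj; rewrite rmorphM /= !rval_nrm normrM. Qed.
Lemma nrmD x y : nrm (x + y) <= nrm x + nrm y.
Proof. by rewrite -ler_rval rmorphD /= !rval_nrm ler_normD. Qed.
Lemma nrmN x : nrm (- x) = nrm x.
Proof. by apply: rval_inj; rewrite !rval_nrm normrN. Qed.
Lemma nrm1 : nrm 1 = 1.
Proof. by apply: rval_inj; rewrite rval_nrm normr1 rmorph1. Qed.
Lemma nrmX x n : nrm (x ^+ n) = nrm x ^+ n.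
Proof. by apply: rval_inj; rewrite rmorphXn /= !rval_nrm normrX. Qed.
Lemma sqE x : sq x = nrm x ^+ 2.
Proof.
by apply: rval_inj; rewrite rmorphD !rmorphXn /= rval_re rval_im rval_nrm normC2_Re_Im.
Qed.
Lemma sq_ge0 x : 0 <= sq x. Proof. by rewrite sqE exprn_ge0 ?nrm_ge0. Qed.
Lemma sqM x y : sq (x * y) = sq x * sq y. Proof. by rewrite !sqE nrmM exprMn. Qed.
Lemma sqN x : sq (- x) = sq x. Proof. by rewrite !sqE nrmN. Qed.
Lemma sq1 : sq 1 = 1. Proof. by rewrite sqE nrm1 expr1n. Qed.
Lemma sq_eq0 x : (sq x == 0) = (x == 0).
Proof.
rewrite sqE sqrf_eq0 -(inj_eq rval_inj) rval_nrm rmorph0; exact: normr_eq0.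
Qed.
Lemma sq_gt0 x : (0 < sq x) = (x != 0). Proof. by rewrite lt0r sq_eq0 sq_ge0 andbT. Qed.
Lemma sqV x : sq x^-1 = (sq x)^-1.
Proof.
have [->|x0] := eqVneq x 0; first by rewrite invr0 (eqP (_ : sq 0 == 0)) ?invr0 // sq_eq0.
have sx : sq x != 0 by rewrite sq_eq0.
by apply: (mulfI sx); rewrite divff // -sqM divff // sq1.
Qed.
Lemma sq_prod (I : Type) (r : seq I) (F : I -> C) :
  sq (\prod_(i <- r) F i) = \prod_(i <- r) sq (F i).
Proof. exact: (big_morph sq sqM sq1). Qed.
Lemma sqC x y : sq (x - y) = sq (y - x).
Proof. by rewrite -sqN opprB. Qed.

Lemma nrm_le x (r : R) : 0 <= r -> (nrm x <= r) = (sq x <= r ^+ 2).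
Proof. by move=> r0; rewrite sqE ler_pXn2r // nnegrE nrm_ge0. Qed.

End RealSubfield.

(** * Real inequalities *)

Section RealInequalities.
Variable R : realFieldType.
Implicit Types x y a : R.

Lemma bernoulli x n : 0 <= x -> 1 + n%:R * x <= (1 + x) ^+ n.
Proof.
move=> x0; elim: n => [|n IHn]; first by rewrite mul0r addr0 expr0.
rewrite exprS -natr1; have : 0 <= n%:R * x * x by rewrite !mulr_ge0.
have : 0 <= (1 + x) * ((1 + x) ^+ n - (1 + n%:R * x)) by rewrite mulr_ge0 ?subr_ge0 //; lra.
lra.
Qed.

(** Multiply by [(1 + x) ^+ n], which is at least 2 by Bernoulli's inequality, while the product is
    at most 1. *)
Lemma expr_1B_le_half x n : 0 <= x <= 1 -> 1 <= n%:R * x -> (1 - x) ^+ n <= 1 / 2.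
Proof.
move=> /andP[x0 x1] nx; have b := bernoulli n x0.
have h : ((1 - x) * (1 + x)) ^+ n <= 1 by rewrite exprn_ile1 //; nra.
have p0 : 0 <= (1 - x) ^+ n by rewrite exprn_ge0 //; lra.
rewrite exprMn in h; nra.
Qed.

Lemma bernoulli_1B x n : 0 <= x <= 1 -> 1 - n%:R * x <= (1 - x) ^+ n.
Proof.
move=> /andP[x0 x1]; elim: n => [|n IHn]; first by rewrite mul0r subr0 expr0.
rewrite exprS -natr1; have : 0 <= n%:R * x * x by rewrite !mulr_ge0.
have : 0 <= (1 - x) * ((1 - x) ^+ n - (1 - n%:R * x)) by rewrite mulr_ge0 ?subr_ge0 //; lra.
lra.
Qed.

(** With [x] the inverse of [n.+1], Bernoulli gives [(1 - x / 2) ^+ n.+1 >= 1 / 2], and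
    [(1 + x) * (1 - x / 2) ^+ 2 <= 1]; no exponential is involved. *)
Lemma expr_1DV_le4 n : (1 + n.+1%:R^-1) ^+ n.+1 <= 4 :> R.
Proof.
set x : R := n.+1%:R^-1.
have x0 : 0 < x by rewrite invr_gt0.
have x1 : x <= 1 by rewrite invf_le1 ?ltr0n // ler1n.
have nx : n.+1%:R * x = 1 by rewrite divff // pnatr_eq0.
have h1 : 1 / 2 <= (1 - x / 2) ^+ n.+1.
  apply: le_trans (bernoulli_1B _ _); last by lra.
  by rewrite mulrA nx; lra.
have h2 : ((1 + x) * (1 - x / 2) ^+ 2) ^+ n.+1 <= 1.
  rewrite exprn_ile1 //; first by rewrite mulr_ge0 ?sqr_ge0 //; lra.
  have -> : (1 + x) * (1 - x / 2) ^+ 2 = 1 - x ^+ 2 * (3 / 4 - x / 4) by field.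
  by rewrite gerBl mulr_ge0 ?sqr_ge0 //; lra.
move: h2; rewrite exprMn exprAC; set P := (1 + x) ^+ _; set Q := (1 - _) ^+ _ in h1 * => h2.
have P0 : 0 <= P by rewrite exprn_ge0 //; lra.
have q2 : 1 / 4 <= Q ^+ 2 by nra.
have : 0 <= P * (Q ^+ 2 - 1 / 4) by rewrite mulr_ge0 ?subr_ge0.
lra.
Qed.

(* The ring may be non-archimedean, hence the explicit bound [N]. *)
Lemma nat_ceil x N : 0 <= x -> x <= N%:R -> exists K : nat, x <= K%:R <= x + 1.
Proof.
move=> x0 xN; pose P K := x <= K%:R.
have exP : exists K, P K by exists N.
case: (ex_minnP exP) => K PK minK; exists K; rewrite (PK : x <= K%:R) /=.
case: K PK minK => [|K] PK minK; first by rewrite addr_ge0.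
rewrite -natr1 lerD2r; apply: ltW; rewrite ltNge; apply/negP => /minK.
by rewrite ltnn.
Qed.

Lemma ler_16X4_2X k : (24 <= k)%N -> 16 * k%:R ^+ 4 <= 2 ^+ k.-1 :> R.
Proof.
move=> /subnKC <-; elim: (k - 24)%N => [|j IHj]; first by rewrite addn0; lra.
rewrite addnS /= -[(24 + j)%N]prednK // [leRHS]exprS prednK //.
set x : R := (24 + j)%:R in IHj *.
have x24 : 24 <= x by rewrite /x natrD lerDl.
have h : (x + 1) ^+ 4 <= (25 / 24 * x) ^+ 4 by rewrite lerXn2r // ?nnegrE; lra.
have h2 : 0 <= x ^+ 4 by rewrite exprn_ge0 //; lra.
rewrite -natr1 -/x; lra.
Qed.

(** Below 24, [a ^+ 4 * (1 - a) <= 1 / 4] suffices. From 24 on, [2 ^+ k.-1] dominates [16 * k ^ 4],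
    and [16 * 6 ^ 4 = 144 ^ 2] accounts for the 6. *)
Lemma exponent_le a k : 0 < a < 1 -> (0 < k)%N ->
  2 ^+ k.-1 * (a * (1 - a)) ^+ 4 < 144 ^+ 2 -> k%:R * (a ^+ 4 * (1 - a)) <= 6.
Proof.
move=> /andP[a0 a1] k0 hk; set t := a ^+ 4 * (1 - a).
have ab0 : 0 < a * (1 - a) by rewrite mulr_gt0 // subr_gt0.
have t0 : 0 < t by rewrite mulr_gt0 ?exprn_gt0 // subr_gt0.
have tu : t <= a * (1 - a).
  rewrite ler_wpM2r ?subr_ge0 ?(ltW a1) // exprS ger_pMr // exprn_ile1 // ltW //.
have [k24|k24] := ltnP k 24.
  have : k%:R <= 23 :> R by rewrite (ler_nat R k 23).
  have : t <= 1 / 4 by have := sqr_ge0 (a - 1 / 2); lra.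
  move=> t4 k23; apply: (@le_trans _ _ (23 * (1 / 4))); last by lra.
  by rewrite ler_pM // ltW.
rewrite leNgt; apply/negP => kt.
have h := ler_16X4_2X k24.
have h1 : 6 ^+ 4 < (k%:R * t) ^+ 4 by rewrite ltrXn2r // nnegrE mulr_ge0 // ltW.
have h2 : (k%:R * t) ^+ 4 <= k%:R ^+ 4 * (a * (1 - a)) ^+ 4.
  by rewrite exprMn ler_wpM2l ?exprn_ge0 // lerXn2r // nnegrE ltW.
have h3 : 16 * k%:R ^+ 4 * (a * (1 - a)) ^+ 4 <= 2 ^+ k.-1 * (a * (1 - a)) ^+ 4.
  by rewrite ler_wpM2r // exprn_ge0 // ltW.
lra.
Qed.

(** Up to constants, [K] is [1 / a], [T] is [1 / (1 - a)], [J] is the inverse square of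
    [a * (1 - a)], and [k] is at most [6 / (a ^ 4 * (1 - a))]. Multiplying these orders yields the
    factor [a ^ 7 * (1 - a) ^ 4]. *)
Lemma parameters a m : 0 < a < 1 -> 144 ^+ 2 <= a ^+ 7 * (1 - a) ^+ 4 * m.+1%:R ->
  exists K T k J : nat, [/\ 8 <= K%:R * a, 2 <= T%:R * (1 - a),
    (8 <= k)%N /\ 144 ^+ 2 <= 2 ^+ k * (a * (1 - a)) ^+ 4,
    24 <= J%:R * (a * (1 - a)) ^+ 2 &
    (J * (9 + 2 * k + 4 * (K.+1 * (T * k))) <= m)%N].
Proof.
move=> /andP[a0 a1] hm; set n := m.+1 in hm *.
have n0 : 0 < n%:R :> R by rewrite ltr0n.
set b := 1 - a in hm *; have b0 : 0 < b by rewrite subr_gt0.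
have b1 : b < 1 by rewrite /b; lra.
pose u := a * b; have u0 : 0 < u by rewrite mulr_gt0.
have u4 : u <= 1 / 4 by rewrite /u /b; have := sqr_ge0 (a - 1 / 2); lra.
have aX i : a ^+ i <= 1 by rewrite exprn_ile1 // ltW.
have bX i : b ^+ i <= 1 by rewrite exprn_ile1 // ltW.
have uX i : 0 < u ^+ i by rewrite exprn_gt0.
have uX1 i : u ^+ i <= 1 by rewrite exprn_ile1 // ltW //; lra.
have hu4 : 144 ^+ 2 <= u ^+ 4 * n%:R.
  apply: (le_trans hm); rewrite ler_wpM2r ?(ltW n0) //.
  have -> : a ^+ 7 * b ^+ 4 = a ^+ 3 * u ^+ 4 by rewrite /u; ring.
  by rewrite ger_pMl.
have hun : 144 ^+ 2 <= u * n%:R.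
  by apply: (le_trans hu4); rewrite ler_wpM2r ?(ltW n0) // exprS ger_pMr.
have hu2n : 144 ^+ 2 <= u ^+ 2 * n%:R.
  by apply: (le_trans hu4); rewrite ler_wpM2r ?(ltW n0) // (exprD u 2 2) ger_pMr.
have ua : u <= a by rewrite /u ger_pMr // ltW.
have ub : u <= b by rewrite /u ger_pMl // ltW.
have [K /andP[K1 K2]] : exists K : nat, 8 / a <= K%:R <= 8 / a + 1.
  apply: (@nat_ceil _ n); first by rewrite divr_ge0 // ltW.
  rewrite ler_pdivrMr // mulrC; apply: (@le_trans _ _ (u * n%:R)); first lra.
  by rewrite ler_wpM2r // ltW.
have [T /andP[T1 T2]] : exists K : nat, 2 / b <= K%:R <= 2 / b + 1.
  apply: (@nat_ceil _ n); first by rewrite divr_ge0 // ltW.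
  rewrite ler_pdivrMr // mulrC; apply: (@le_trans _ _ (u * n%:R)); first lra.
  by rewrite ler_wpM2r // ltW.
have [J /andP[J1 J2]] : exists K : nat, 24 / u ^+ 2 <= K%:R <= 24 / u ^+ 2 + 1.
  apply: (@nat_ceil _ n); first by rewrite divr_ge0 // ltW.
  by rewrite ler_pdivrMr // mulrC; lra.
move: K1 T1 J1; rewrite !ler_pdivrMr // => K1 T1 J1.
have {}K2 : K.+1%:R * a <= 10.
  have : K%:R * a <= (8 / a + 1) * a by rewrite ler_wpM2r // ltW.
  by rewrite mulrDl divfK ?gt_eqF // -natr1; lra.
have {}T2 : T%:R * b <= 3.
  have : T%:R * b <= (2 / b + 1) * b by rewrite ler_wpM2r // ltW.
  by rewrite mulrDl divfK ?gt_eqF //; lra.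
have {}J2 : J%:R * u ^+ 2 <= 25.
  have : J%:R * u ^+ 2 <= (24 / u ^+ 2 + 1) * u ^+ 2 by rewrite ler_wpM2r // ltW.
  by rewrite mulrDl divfK ?gt_eqF //; have := uX1 2%N; lra.
(* Taking the least such [k] makes the inequality fail at [k.-1], as [exponent_le] requires; [n] is
   a candidate because [n <= 2 ^ n]. *)
pose P k := 144 ^+ 2 <= 2 ^+ k * u ^+ 4.
have exP : exists k, P k.
  exists n; apply: (@le_trans _ _ (u ^+ 4 * n%:R)); first by lra.
  by rewrite mulrC ler_wpM2r ?(ltW (uX _)) // -natrX ler_nat ltnW // ltn_expl.
case: (ex_minnP exP) => k Pk mink.
have k8 : (8 <= k)%N.
  rewrite leqNgt; apply/negP => k8; move: Pk; rewrite /P leNgt => /negP; apply.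
  have : 2 ^+ k <= 2 ^+ 8 :> R by rewrite ler_eXn2l ?ltr1n // ltnW.
  have := uX1 4%N; have := uX 4%N => h1 h2 h3.
  apply: (@le_lt_trans _ _ (2 ^+ 8 * 1)); last by lra.
  by rewrite ler_pM // ?exprn_ge0 // ltW.
have k0 : (0 < k)%N by apply: leq_trans k8.
have kle : k%:R * (a ^+ 4 * b) <= 6.
  apply: exponent_le => //; first by rewrite a0.
  by rewrite -/b -/u ltNge; apply/negP => /mink; rewrite leqNgt ltn_predL k0.
exists K, T, k, J; split=> //.
have k8R : 8 <= k%:R :> R by rewrite (ler_nat R 8 k).
pose Z := (9 + 2 * k + 4 * (K.+1 * (T * k)))%N.
have hZ : Z%:R * u <= 124 * k%:R.
  have -> : Z%:R = 9 + 2 * k%:R + 4 * (K.+1%:R * (T%:R * k%:R)) :> R.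
    by rewrite /Z; ring.
  have h1 : (K.+1%:R * a) * (T%:R * b) <= 10 * 3.
    by rewrite ler_pM // mulr_ge0 // ltW.
  have h2 : 4 * k%:R * ((K.+1%:R * a) * (T%:R * b)) <= 4 * k%:R * (10 * 3).
    by rewrite ler_wpM2l //; lra.
  have h3 : (9 + 2 * k%:R) * u <= 4 * k%:R * 1 by rewrite ler_pM //; lra.
  rewrite /u in h3 *; lra.
have hJZ : (J * Z)%:R * u ^+ 3 <= 31 * 100 * k%:R.
  have : (J%:R * u ^+ 2) * (Z%:R * u) <= 25 * (124 * k%:R).
    by rewrite ler_pM // mulr_ge0 // ltW.
  rewrite natrM; lra.
(* Here [25 * 124 * 6 = 18600], which is below [144 ^ 2 = 20736]. *)
have hfin : (J * Z)%:R * (a ^+ 7 * b ^+ 4) <= 186 * 100.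
  have -> : (J * Z)%:R * (a ^+ 7 * b ^+ 4) = ((J * Z)%:R * u ^+ 3) * (a ^+ 4 * b).
    by rewrite /u; ring.
  apply: (@le_trans _ _ (31 * 100 * k%:R * (a ^+ 4 * b))); last by lra.
  by rewrite ler_wpM2r // mulr_ge0 ?exprn_ge0 // ltW.
rewrite -ltnS -/n -/Z -(ltr_nat R).
have ab0 : 0 < a ^+ 7 * b ^+ 4 by rewrite mulr_gt0 ?exprn_gt0.
by rewrite -(ltr_pM2r ab0); lra.
Qed.

End RealInequalities.

(** * Bounds for the step length [e] *)

Section Step.
Variables (R : realFieldType) (a : R).
Hypotheses (a0 : 0 < a) (a1 : a < 1).
Local Notation e := (a * (1 - a) ^+ 2 / 9).

Lemma step_bounds : [/\ 0 < e, e <= a / 9, e <= (1 - a) / 9 & e * a <= 1 / 9].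
Proof.
set b := 1 - a.
have b0 : 0 < b by rewrite subr_gt0.
have b1 : b <= 1 by rewrite gerBl ltW.
have b2 : b ^+ 2 <= 1 by rewrite exprn_ile1 // ltW.
have e0 : 0 < a * b ^+ 2 / 9 by rewrite divr_gt0 // mulr_gt0 // exprn_gt0.
have ea : a * b ^+ 2 / 9 <= a / 9 by rewrite ler_pM2r ?invr_gt0 // ger_pMr.
split=> //.
  by rewrite ler_pM2r ?invr_gt0 // expr2 mulrA ger_pMl // mulr_ile1 // ltW.
by apply: le_trans (_ : a * b ^+ 2 / 9 <= _); [rewrite ger_pMr // ltW|move: a1; lra].
Qed.

Lemma step_large (n : R) : 0 < n -> 144 ^+ 2 <= a ^+ 7 * (1 - a) ^+ 4 * n ->
  72 <= n * (e * a).
Proof.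
set b := 1 - a => n0 hn.
have b0 : 0 < b by rewrite subr_gt0.
have b1 : b <= 1 by rewrite gerBl ltW.
have -> : n * (a * b ^+ 2 / 9 * a) = (a ^+ 2 * b ^+ 2 * n) / 9 by field.
have : a ^+ 7 * b ^+ 4 * n <= a ^+ 2 * b ^+ 2 * n.
  rewrite ler_pM2r // (exprD a 2 5) (exprD b 2 2) mulrACA.
  by rewrite ger_pMr ?mulr_gt0 ?exprn_gt0 // mulr_ile1 // ?exprn_ge0 ?exprn_ile1 // ltW.
lra.
Qed.

(** Since [e * a] is [(a * (1 - a)) ^+ 2 / 9], the constant is [16 * 9 = 144]. *)
Lemma step_sqr (V : R) : 144 ^+ 2 <= V * (a * (1 - a)) ^+ 4 -> (16 / (e * a)) ^+ 2 <= V.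
Proof.
set b := 1 - a => hV; have b0 : 0 < b by rewrite subr_gt0.
have ea0 : 0 < a * b ^+ 2 / 9 * a by rewrite mulr_gt0 // divr_gt0 // mulr_gt0 // exprn_gt0.
rewrite expr_div_n ler_pdivrMr ?exprn_gt0 //.
have -> : (a * b ^+ 2 / 9 * a) ^+ 2 = (a * b) ^+ 4 / 81 by field.
lra.
Qed.

End Step.

(** * Numerical form of the final comparison *)

Section Gap.
Variable R : realFieldType.
Implicit Types a e n x y d w V : R.

Lemma left_mass a e n : 0 < n -> 0 < e <= a / 9 -> 72 <= n * (e * a) ->
  1 <= n * (2 * e * (a - 2 * e) / 2).
Proof.
move=> n0 /andP[e0 ea] nea.
have : 0 <= n * e * (a / 9 - e) by rewrite !mulr_ge0 ?subr_ge0 // ltW.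
lra.
Qed.

(** The quantity is the parameter [t * (a - t) / 2] of [lune_left] at [t = e / 2]; it is at least
    [e * a / 8]. *)
Lemma left_scale a e : 0 < e <= a / 9 -> a < 1 ->
  [/\ 0 < e / 2 * (a - e / 2) / 2, e / 2 * (a - e / 2) / 2 <= 1 &
      (2 / (e / 2 * (a - e / 2) / 2)) ^+ 2 <= (16 / (e * a)) ^+ 2].
Proof.
move=> /andP[e0 ea] a1.
have a0 : 0 < a by lra.
have ea0 := mulr_gt0 e0 a0.
have h : e * a / 8 <= e / 2 * (a - e / 2) / 2.
  by have : 0 <= e * (a / 9 - e) by [rewrite mulr_ge0 ?subr_ge0 // ltW]; lra.
have x0 : 0 < e / 2 * (a - e / 2) / 2 by lra.
split=> //; first by nra.
move: x0 h; set x := _ / 2 => x0 h.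
have p1 : 0 <= 2 / x by rewrite divr_ge0 // ltW.
have p2 : 0 <= 16 / (e * a) by rewrite divr_ge0 // ltW.
rewrite lerXn2r ?nnegrE // ler_pdivrMr //.
apply: (@le_trans _ _ (16 / (e * a) * (e * a / 8))).
  by rewrite mulrA divfK ?gt_eqF //; lra.
by rewrite ler_wpM2l // divr_ge0 // ltW.
Qed.

(** For [V = 2 ^+ k], this turns the zero-free radius of [root_far] about [a - e / 2] into the
    hypothesis of [star_le]. *)
Lemma far_scale a e V x : 0 < e -> 0 < a -> (16 / (e * a)) ^+ 2 <= V ->
  (a * (e / 2) / 4) ^+ 2 <= x -> 4 <= V * x.
Proof.
move=> e0 a0 hV hx.
apply: (@le_trans _ _ ((16 / (e * a)) ^+ 2 * (a * (e / 2) / 4) ^+ 2)).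
  rewrite le_eqVlt; apply/orP; left; apply/eqP.
  by field; rewrite !gt_eqF.
by rewrite ler_pM ?sqr_ge0.
Qed.

(** Here [sd], [s1], [s2] stand for [|q|^2] at [a + e], [a - e / 2], [a - 2 e], and [y] for
    [e * a / 4]. The factor [lam ^+ 2] cancels, and [(1 + 3 / 2 * y) * (1 + y) ^+ 2 <= 1 + 4 * y]
    for [y <= 1 / 36]. *)
Lemma growth_gap (m : nat) y lam sd s2 s1 V w : 0 < lam -> 0 <= V -> 0 <= w ->
  0 <= y <= 1 / 36 ->
  lam * (1 + 4 * y) ^+ m / 16 <= sd -> lam / 16 <= s2 ->
  0 <= s1 <= lam * V * w -> sd * s2 <= s1 ^+ 2 * ((1 + y) ^+ 2) ^+ m ->
  (1 + 3 / 2 * y) ^+ m <= 256 * (V * w) ^+ 2.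
Proof.
move=> lam0 V0 w0 /andP[y0 y1] hd h2 /andP[s10 h1] hs.
have Y0 : 0 < ((1 + y) ^+ 2) ^+ m by rewrite exprn_gt0 // exprn_gt0 //; lra.
have key : (1 + 4 * y) ^+ m <= 256 * (V * w) ^+ 2 * ((1 + y) ^+ 2) ^+ m.
  have k1 : lam * (1 + 4 * y) ^+ m / 16 * (lam / 16) <= sd * s2.
    by rewrite ler_pM // ?divr_ge0 ?mulr_ge0 ?exprn_ge0 ?(ltW lam0) //; lra.
  have k2 : s1 ^+ 2 <= (lam * V * w) ^+ 2.
    by rewrite lerXn2r // ?nnegrE ?mulr_ge0 ?(ltW lam0).
  have k3 : s1 ^+ 2 * ((1 + y) ^+ 2) ^+ m <= (lam * V * w) ^+ 2 * ((1 + y) ^+ 2) ^+ m.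
    by rewrite ler_wpM2r // ltW.
  rewrite -(ler_pM2l (exprn_gt0 2 lam0)).
  have := le_trans (le_trans k1 hs) k3.
  by move: (((1 + y) ^+ 2) ^+ m) ((1 + 4 * y) ^+ m) => Y X; clear; lra.
rewrite -(ler_pM2r Y0); apply: le_trans key; rewrite -exprMn lerXn2r // ?nnegrE.
- by rewrite mulr_ge0 ?sqr_ge0 //; lra.
- by lra.
have : 0 <= y * (1 / 36 - y) by rewrite mulr_ge0 ?subr_ge0.
have : 0 <= y ^+ 2 * (1 / 36 - y) by rewrite mulr_ge0 ?sqr_ge0 ?subr_ge0.
lra.
Qed.

(** By Bernoulli [(1 + d) ^+ J >= 2], so the right side reaches the power of 2 with exponent
    [9 + 2 * k + 4 * (K * E)], one more than bounds the left side. *)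
Lemma exponent_gap (m k K E J : nat) d w :
  0 <= d -> 1 <= J%:R * d -> 0 <= w <= (4 ^+ K) ^+ E ->
  (J * (9 + 2 * k + 4 * (K * E)) <= m)%N ->
  256 * (2 ^+ k * w) ^+ 2 < (1 + d) ^+ m.
Proof.
move=> d0 hJ /andP[w0 hw] hm.
have key : 256 * (2 ^+ k * w) ^+ 2 <= 2 ^+ (8 + 2 * k + 4 * (K * E)).
  have ww : w <= 2 ^+ (2 * (K * E)).
    by rewrite exprM (_ : 2 ^+ 2 = 4 :> R) ?exprM //; ring.
  rewrite (_ : 8 + 2 * k + 4 * (K * E) = 8 + (k + 2 * (K * E)) * 2)%N; last by ring.
  rewrite exprD exprM exprD (_ : 2 ^+ 8 = 256 :> R); last by ring.
  by rewrite ler_wpM2l // lerXn2r ?nnegrE ?ler_wpM2l ?mulr_ge0 ?exprn_ge0.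
apply: (le_lt_trans key).
apply: (@lt_le_trans _ _ (2 ^+ (9 + 2 * k + 4 * (K * E)))).
  by rewrite ltr_eXn2l ?ltr1n // !addSn.
apply: (@le_trans _ _ ((1 + d) ^+ (J * (9 + 2 * k + 4 * (K * E))))); last first.
  by rewrite ler_weXn2l // lerDl.
rewrite exprM lerXn2r // ?nnegrE ?exprn_ge0 ?addr_ge0 //.
by have := bernoulli J d0; lra.
Qed.

End Gap.

(** * Laguerre's and Grace's theorems *)

Section Grace.
Variable C : numClosedFieldType.
Local Notation R := (creal C).
Implicit Types (z u b c : C) (q : R) (s : seq C).

Lemma deriv_prod_XsubC s z : z \notin s ->
  (\prod_(g <- s) ('X - g%:P))^`().[z] =
  (\prod_(g <- s) (z - g)) * \sum_(g <- s) (z - g)^-1.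
Proof.
elim: s => [|g s IHs]; first by rewrite !big_nil derivC horner0 mulr0.
rewrite inE negb_or => /andP[zg /IHs {}IHs]; rewrite !big_cons derivM derivXsubC.
rewrite mul1r hornerD hornerM IHs horner_prod hornerXsubC.
under eq_bigr do rewrite hornerXsubC.
have zg0 : z - g != 0 by rewrite subr_eq0.
by field.
Qed.

(** The mean of points of an open half-plane stays in it; the form with [size s] avoids a
    division. *)
Lemma re_sum_gt0 s (h : C -> C) (k : R) (beta : C) : s != [::] ->
  {in s, forall g, 0 < k + re (beta * h g)} ->
  0 < (size s)%:R * k + re (beta * \sum_(g <- s) h g).
Proof.
elim: s => // g s IHs _ hs; have hg := hs g (mem_head g s).
rewrite big_cons mulrDr reD /= -natr1 mulrDl mul1r.
have [->|sN] := eqVneq s [::]; first by rewrite big_nil /= mulr0 re0; lra.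
have := IHs sN (fun x xs => hs x (@mem_behead _ (g :: s) x xs)); lra.
Qed.

(** For [q ^+ 2 < 1] this is a closed disk containing [c], and avoiding [b] when [c != b]. *)
Definition apollonius c b q z := sq (c - z) <= q ^+ 2 * sq (b - z).

(** Laguerre's theorem on the polar derivative. In the variable [1 / (z - g)], the equation says
    that the values at the roots sum to [k] times the value at [u]. If all roots were outside the
    disk, a concave function positive at each of them would be positive at [u] too. *)
Lemma laguerre c b q (k : nat) (G : {poly C}) u z : q ^+ 2 < 1 ->
  (0 < k)%N -> (size G <= k.+1)%N ->
  apollonius c b q u -> apollonius c b q z ->
  k%:R * G.[z] + (u - z) * G^`().[z] = 0 ->
  exists2 g, apollonius c b q g & G.[g] = 0.
Proof.
move=> q1 k_gt0 sG Du Dz eq0.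
have [G0|GN0] := eqVneq G 0; first by exists z; rewrite // G0 horner0.
have [s Gs] := closed_field_poly_normal G.
have lG : lead_coef G != 0 by rewrite lead_coef_eq0.
have ss : (size s <= k)%N by move: sG; rewrite Gs size_scale // size_prod_XsubC.
have [/hasP[g gs Dg]|/hasPn noD] := boolP (has (apollonius c b q) s).
  exists g => //; apply/eqP; rewrite -/(root G g) Gs rootZ // root_prod_XsubC //.
exfalso.
have zs : z \notin s by apply: contraL Dz => /noD.
have pN0 : \prod_(g <- s) (z - g) != 0.
  by rewrite prodf_seq_neq0; apply/allP => g gs /=; rewrite subr_eq0; apply: contraNneq zs => ->.
pose Y := \sum_(g <- s) (z - g)^-1.
have kY : k%:R + (u - z) * Y = 0.
  move: eq0; rewrite Gs derivZ !hornerZ deriv_prod_XsubC // horner_prod.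
  under eq_bigr do rewrite hornerXsubC.
  set p := \prod_(_ <- _) _ => e; apply: (mulfI (mulf_neq0 lG pN0)); rewrite mulr0 -[RHS]e /Y.
  by rewrite -/p; ring.
have kN0 : k%:R != 0 :> C by rewrite pnatr_eq0 -lt0n.
have zu : z - u != 0.
  by apply: contra_eq_neq kY => /eqP; rewrite subr_eq0 => /eqP ->; rewrite subrr mul0r addr0.
pose y0 := (z - u)^-1.
have YE : Y = k%:R * y0.
  have kE : k%:R = (z - u) * Y.
    by apply/eqP; rewrite -subr_eq0 -[X in _ == X]kY; apply/eqP; ring.
  by rewrite kE /y0 mulrAC divff // mul1r.
have sN : s != [::].
  apply: contra_neq kN0 => s0; move: kY; rewrite /Y s0 big_nil mulr0 addr0 //.
pose v := c - z; pose w := b - z.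
pose A := q ^+ 2 * sq w - sq v.
have A0 : 0 <= A by rewrite subr_ge0.
pose B := v - rval (q ^+ 2) * w.
(* [g] lies outside the disk iff [E (z - g)^-1 > 0]; [E] is concave, and its tangent at [y0]
   is [k0 + re (beta * y)]. *)
pose E y := sq (v * y + 1) - q ^+ 2 * sq (w * y + 1).
have EN0 g : z - g != 0 -> E (z - g)^-1 = (sq (z - g))^-1 * (sq (c - g) - q ^+ 2 * sq (b - g)).
  move=> zg; rewrite /E.
  have -> : v * (z - g)^-1 + 1 = (c - g) * (z - g)^-1 by rewrite /v; field.
  have -> : w * (z - g)^-1 + 1 = (b - g) * (z - g)^-1 by rewrite /w; field.
  by rewrite !sqM !sqV; ring.
pose k0 := 1 - q ^+ 2 + A * sq y0.
pose beta := (1 + 1) * (B - rval A * y0^*).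
have Ele y : E y <= k0 + re (beta * y).
  rewrite /E /k0 /beta /B /A /sq !coordE.
  have : 0 <= A * sq (y - y0) by rewrite mulr_ge0 ?sq_ge0.
  rewrite /A /sq !coordE; lra.
have Ey0 : E y0 = k0 + re (beta * y0).
  rewrite /E /k0 /beta /B /A /sq !coordE; ring.
have gt0 : 0 < (size s)%:R * k0 + re (beta * Y).
  apply: re_sum_gt0 => // g gs; apply: lt_le_trans (Ele _).
  have zg : z - g != 0 by rewrite subr_eq0; apply: contraNneq zs => ->.
  rewrite EN0 // mulr_gt0 ?invr_gt0 ?sq_gt0 // subr_gt0.
  by have := noD g gs; rewrite /apollonius -ltNge.
(* Since [k0 >= 0], the count [size s] may be raised to [k]: the missing roots act as roots at
   infinity, which lie outside the disk. *)
have : 0 < k%:R * E y0.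
  apply: (lt_le_trans gt0); rewrite Ey0 YE.
  have -> : re (beta * (k%:R * y0)) = k%:R * re (beta * y0).
    by rewrite mulrCA [LHS]reM -(rmorph_nat (@rval C)) re_rval im_rval mul0r subr0.
  rewrite [leRHS]mulrDr lerD2r ler_wpM2r ?ler_nat //.
  by rewrite addr_ge0 ?mulr_ge0 ?sq_ge0 ?subr_ge0 // ltW.
rewrite pmulr_rgt0 ?ltr0n // EN0 // pmulr_rgt0 ?invr_gt0 ?sq_gt0 // subr_gt0.
by rewrite ltNge; move: Du; rewrite /apollonius => ->.
Qed.

Section Functional.
Variable l : {scalar {poly C}}.

Fixpoint translates (f : {poly C}) (k : nat) : {poly C} :=
  if k is k'.+1 then translates (f * 'X) k' - 'X * translates f k' else (l f)%:P.

Lemma horner_translates f k z : (translates f k).[z] = l (f * ('X - z%:P) ^+ k).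
Proof.
elim: k f => [|k IHk] f /=; first by rewrite hornerC expr0 mulr1.
rewrite hornerD hornerN hornerM hornerX !IHk -[z * _]linearZ -linearB /=.
by congr (l _); rewrite exprS -mul_polyC; ring.
Qed.

Lemma size_translates f k : (size (translates f k) <= k.+1)%N.
Proof.
elim: k f => [|k IHk] f /=; first exact: size_polyC_leq1.
apply: leq_trans (size_polyD _ _) _; rewrite size_polyN geq_max.
rewrite (leq_trans (IHk _)) //= mulrC.
have [->|tN] := eqVneq (translates f k) 0; first by rewrite mul0r size_poly0.
by rewrite size_mulX // ltnS.
Qed.

(** Differentiation is in [z]. Hence the polar derivative of [translates f k.+1] replaces one factor
    ['X - z%:P] by ['X - u%:P], up to the scalar [k.+1]. *)
Lemma deriv_translates f k :
  (translates f k.+1)^`() = - (k.+1%:R *: translates f k).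
Proof.
have translatesS g i : translates g i.+1 = translates (g * 'X) i - 'X * translates g i by [].
elim: k f => [|k IHk] f.
  by rewrite /= derivB derivC derivM derivX derivC mulr0 addr0 mul1r sub0r scale1r.
rewrite translatesS derivB derivM derivX !IHk translatesS -!mul_polyC -[k.+2%:R]natr1.
rewrite polyCD polyC1; ring.
Qed.

(** Induction on [s] with [f] general: all roots but [g] are first merged into one [z], with
    ['X - g%:P] absorbed in [f]. What remains is a vanishing polar derivative, so [laguerre] merges
    [g] as well. *)
Theorem grace c b q f s : q ^+ 2 < 1 -> all (apollonius c b q) s ->
  l (f * \prod_(g <- s) ('X - g%:P)) = 0 ->
  exists2 z, apollonius c b q z & l (f * ('X - z%:P) ^+ size s) = 0.
Proof.
move=> q1; elim: s f => [|g s IHs] f /=.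
  move=> _; rewrite big_nil => l0; exists c; last by rewrite expr0.
  by rewrite /apollonius subrr /sq re0 im0 !expr0n /= addr0 mulr_ge0 ?sqr_ge0 ?sq_ge0.
move=> /andP[Dg Ds]; rewrite big_cons mulrA => /(IHs _ Ds)[z Dz lz].
have [] := @laguerre c b q (size s).+1 (translates f (size s).+1) g z q1 _ _ Dg Dz => //.
- exact: size_translates.
- rewrite deriv_translates hornerN hornerZ !horner_translates.
  have -> : l (f * ('X - z%:P) ^+ (size s).+1) = (g - z) * l (f * ('X - z%:P) ^+ size s).
    rewrite -linearZ /= -[RHS]add0r -lz -linearD /=; congr (l _).
    by rewrite exprS -mul_polyC polyCB; ring.
  ring.
- by move=> w Dw; rewrite horner_translates => lw; exists w.
Qed.

End Functional.
End Grace.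

(** * Coincidence for integrals *)

Section Coincidence.
Variable C : numClosedFieldType.
Local Notation R := (creal C).
Implicit Types (b c u z : C) (q : R) (s : seq C) (f F : {poly C}).

(* The constant coefficient is 0 because of [x / 0 = 0]. *)
Definition prim f : {poly C} := \poly_(i < (size f).+1) (f`_i.-1 / i%:R).

Lemma coef_prim f i : (prim f)`_i = f`_i.-1 / i%:R.
Proof.
rewrite coef_poly; case: ltnP => // si; rewrite nth_default ?mul0r //.
by case: i si.
Qed.

Lemma prim_is_linear : linear prim.
Proof.
move=> k f g; apply/polyP=> i; rewrite coefD coefZ !coef_prim coefD coefZ; ring.
Qed.

Lemma prim_deriv F : prim F^`() = F - (F`_0)%:P.
Proof.
apply/polyP=> i; rewrite coef_prim coefB coefC coef_deriv.
case: i => [|i] /=; first by rewrite invr0 mulr0 subrr.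
by rewrite subr0 -(mulr_natr F`_i.+1) mulfK ?pnatr_eq0.
Qed.

(** The integral of [f] from [c] to [b], minus [tau] times the value at [b]. *)
Definition int_sub_eval b c (tau : C) f : C :=
  (prim f).[b] - (prim f).[c] - tau * f.[b].

Lemma int_sub_eval_scalar b c tau : scalar (int_sub_eval b c tau).
Proof.
move=> k f g; rewrite /int_sub_eval prim_is_linear !hornerD !hornerZ; ring.
Qed.

HB.instance Definition _ b c tau :=
  GRing.isLinear.Build C {poly C} C *%R (int_sub_eval b c tau)
    (int_sub_eval_scalar b c tau).

Lemma int_sub_eval_deriv b c tau F :
  int_sub_eval b c tau F^`() = F.[b] - F.[c] - tau * F^`().[b].
Proof. by rewrite /int_sub_eval prim_deriv !hornerD !hornerN !hornerC; ring. Qed.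

(** Grace's theorem replaces the derivative of [F] by a power of ['X - z%:P], whose integral is
    explicit; [u] is [(c - z) / (b - z)]. *)
Theorem coincidence b c q s F : 0 <= q < 1 -> c != b ->
  all (apollonius c b q) s -> F^`() = \prod_(g <- s) ('X - g%:P) ->
  exists2 u, nrm u <= q & F.[b] - F.[c] =
    F^`().[b] * (b - c) * ((1 - u ^+ (size s).+1) / ((size s).+1%:R * (1 - u))).
Proof.
move=> /andP[q0 q1] cb Ds dF.
have q21 : q ^+ 2 < 1 by rewrite expr_lt1.
have bz z : apollonius c b q z -> b - z != 0.
  move=> Dz; apply: contra_neq cb => /eqP; rewrite subr_eq0 => /eqP bz.
  move: Dz; rewrite /apollonius bz subrr.
  have -> : sq (0 : C) = 0 by apply/eqP; rewrite sq_eq0.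
  by rewrite mulr0 le_eqVlt ltNge sq_ge0 orbF sq_eq0 subr_eq0 => /eqP.
have dFb : F^`().[b] != 0.
  rewrite dF horner_prod prodf_seq_neq0; apply/allP => g /(allP Ds) /bz.
  by rewrite hornerXsubC.
(* This choice makes the functional vanish at the derivative of [F]. *)
pose tau := (F.[b] - F.[c]) / F^`().[b].
have [] := @grace C (int_sub_eval b c tau) c b q 1 s q21 Ds.
  by rewrite mul1r -dF /= int_sub_eval_deriv /tau divfK // subrr.
move=> z Dz; rewrite mul1r /= => lz; have zb := bz z Dz.
set n := (size s).+1 in lz *.
have nN0 : n%:R != 0 :> C by rewrite pnatr_eq0.
have tauE : n%:R * (tau * (b - z) ^+ size s) = (b - z) ^+ n - (c - z) ^+ n.
  have := int_sub_eval_deriv b c tau (('X - z%:P) ^+ n).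
  rewrite deriv_exp derivXsubC mul1r -scaler_nat linearZ /= lz mulr0.
  rewrite hornerZ !horner_exp !hornerXsubC => /esym/eqP; rewrite subr_eq0 => /eqP ->.
  by rewrite mulrCA.
exists ((c - z) / (b - z)).
  by rewrite nrm_le // sqM sqV ler_pdivrMr ?sq_gt0.
have -> : F.[b] - F.[c] = F^`().[b] * tau by rewrite /tau mulrCA divff ?mulr1.
rewrite -mulrA; congr (_ * _).
have bc : b - c != 0 by rewrite subr_eq0 eq_sym.
have e0 : (b - z) ^+ size s != 0 by rewrite expf_neq0.
apply: (mulfI (mulf_neq0 nN0 e0)).
have -> : n%:R * (b - z) ^+ size s * tau = (b - z) ^+ n - (c - z) ^+ n by rewrite -tauE; ring.
rewrite expr_div_n /n !exprS.
by field; rewrite zb e0 nat1r nN0 opprB addrA subrK bc.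
Qed.

End Coincidence.

(** * Values of the polynomial *)

Section Values.
Variable C : numClosedFieldType.
Local Notation R := (creal C).
Implicit Types (b c u w g : C) (q x : R).

(** If [|w| > 1], each [w / (w - g)] is closer to 0's opposite side than to it: it is nearer to 1
    than to 0, so its real part is positive and the logarithmic derivative cannot vanish. *)
Lemma gauss_lucas (zs : seq C) w : {in zs, forall g, sq g <= 1} -> zs != [::] ->
  root (\prod_(g <- zs) ('X - g%:P))^`() w -> sq w <= 1.
Proof.
move=> hz zN; have [/hz //|wz] := boolP (w \in zs).
rewrite /root deriv_prod_XsubC // mulf_eq0 prodf_seq_eq0 => /orP[/hasP[g gs]|].
  by rewrite subr_eq0 => /eqP wg; rewrite wg gs in wz.
move=> /eqP s0; rewrite leNgt; apply/negP => w1.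
have := @re_sum_gt0 C zs (fun g => (w - g)^-1) 0 w zN.
rewrite s0 !mulr0 re0 addr0 ltxx => H; apply: notF; apply: H => g gs.
have wg : w - g != 0 by rewrite subr_eq0; apply: contraNneq wz => ->.
have y0 : 0 < sq (w - g)^-1 by rewrite sq_gt0 invr_eq0.
have e : g * (w - g)^-1 = w * (w - g)^-1 - 1 by field.
have : sq (w * (w - g)^-1 - 1) < sq (w * (w - g)^-1).
  by rewrite -e !sqM ltr_pM2r // (le_lt_trans (hz g gs)).
rewrite {1 2}/sq !(reD, imD, reN, imN) re1 im1; lra.
Qed.

(** Here [|u| ^ n <= 1 / 2] and [|1 - u| <= 2], so the quotient has modulus at least [1 / 4]. *)
Lemma sq_geom_ge u x n : 0 < x <= 1 -> 1 <= n%:R * x -> nrm u <= 1 - x ->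
  1 / 16 <= sq ((1 - u ^+ n) / (1 - u)).
Proof.
move=> /andP[x0 x1] nx ux.
have un : nrm u ^+ n <= 1 / 2.
  apply: le_trans (expr_1B_le_half _ nx); last by rewrite (ltW x0).
  by rewrite lerXn2r // ?nnegrE ?nrm_ge0 //; lra.
have u1 : 0 < nrm (1 - u).
  have := nrmD (1 - u) u; rewrite subrK nrm1; lra.
have u2 : nrm (1 - u) <= 2 by have := nrmD 1 (- u); rewrite nrmN nrm1; lra.
have h : 1 / 2 <= nrm (1 - u ^+ n).
  have := nrmD (1 - u ^+ n) (u ^+ n); rewrite subrK nrm1 nrmX; lra.
rewrite sqM sqV !sqE ler_pdivlMr ?exprn_gt0 //; nra.
Qed.

Lemma sq_geom_le u x n : 0 < x <= 1 -> nrm u <= 1 - x ->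
  sq ((1 - u ^+ n) / (1 - u)) <= (2 / x) ^+ 2.
Proof.
move=> /andP[x0 x1] ux.
have un : nrm u ^+ n <= 1 by rewrite exprn_ile1 ?nrm_ge0 //; lra.
have u1 : x <= nrm (1 - u).
  have := nrmD (1 - u) u; rewrite subrK nrm1; lra.
have h : nrm (1 - u ^+ n) <= 2 by have := nrmD 1 (- u ^+ n); rewrite nrmN nrm1 nrmX; lra.
rewrite sqM sqV !sqE expr_div_n ler_pM ?invr_ge0 ?sqr_ge0 //.
  by rewrite lerXn2r // ?nnegrE ?nrm_ge0.
by rewrite lef_pV2 ?posrE ?exprn_gt0 ?(lt_le_trans x0) // lerXn2r // ?nnegrE ?ltW //
  (lt_le_trans x0).
Qed.

Section Critical.
(* [a] is the distinguished root, [zs] the other roots and [s] the critical points. *)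
Variables (a : C) (zs s : seq C).
Hypothesis ds : (('X - a%:P) * \prod_(g <- zs) ('X - g%:P))^`() =
  (size s).+1%:R *: \prod_(g <- s) ('X - g%:P).
Local Notation n := (size s).+1.
Local Notation p := (\prod_(g <- zs) ('X - g%:P)).

Let F := n%:R^-1 *: (('X - a%:P) * p).

Let nN0 : n%:R != 0 :> C. Proof. by rewrite pnatr_eq0. Qed.

Let dF : F^`() = \prod_(g <- s) ('X - g%:P).
Proof. by rewrite /F derivZ ds scalerA mulVf // scale1r. Qed.

Let FE w : F.[w] = n%:R^-1 * (w - a) * p.[w].
Proof. by rewrite /F hornerZ hornerM hornerXsubC mulrA. Qed.

Let hp w : (\prod_(g <- s) ('X - g%:P)).[w] = \prod_(g <- s) (w - g).
Proof. by rewrite horner_prod; apply: eq_bigr => g _; rewrite hornerXsubC. Qed.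

(** The base point of [coincidence] is the root [a], where the integrated polynomial vanishes; in
    [value_right] the base point is [b] and [a] is the other endpoint. *)
Lemma value_left c x : c != a -> 0 < x <= 1 ->
  all (apollonius c a (1 - x)) s ->
  exists2 u, nrm u <= 1 - x &
    p.[c] = \prod_(g <- s) (a - g) * ((1 - u ^+ n) / (1 - u)).
Proof.
move=> ca /andP[x0 x1] Ds.
have q01 : 0 <= 1 - x < 1 by lra.
have [u uq] := coincidence q01 ca Ds dF.
rewrite !FE subrr mulr0 mul0r dF hp => e; exists u => //.
have u1 : 1 - u != 0.
  rewrite subr_eq0; apply: contraTneq uq => <-; rewrite nrm1; lra.
have ca0 : c - a != 0 by rewrite subr_eq0.
have -> : p.[c] = (0 - n%:R^-1 * (c - a) * p.[c]) * n%:R / (a - c).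
  by field; rewrite nat1r nN0 -opprB oppr_eq0 ca0.
by rewrite e; field; rewrite u1 nat1r nN0 -opprB oppr_eq0 ca0.
Qed.

Lemma value_right b x : a != b -> 0 < x <= 1 ->
  all (apollonius a b (1 - x)) s ->
  exists2 u, nrm u <= 1 - x &
    p.[b] = \prod_(g <- s) (b - g) * ((1 - u ^+ n) / (1 - u)).
Proof.
move=> ab /andP[x0 x1] Ds.
have q01 : 0 <= 1 - x < 1 by lra.
have [u uq] := coincidence q01 ab Ds dF.
rewrite !FE subrr mulr0 mul0r subr0 dF hp => e; exists u => //.
have u1 : 1 - u != 0.
  rewrite subr_eq0; apply: contraTneq uq => <-; rewrite nrm1; lra.
have ba0 : b - a != 0 by rewrite subr_eq0 eq_sym.
have -> : p.[b] = (n%:R^-1 * (b - a) * p.[b]) * n%:R / (b - a).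
  by field; rewrite nat1r nN0 ba0.
by rewrite e; field; rewrite u1 nat1r nN0 ba0.
Qed.

End Critical.
End Values.

(** * The lune and the reflected factors *)

Section Lune.
Variable C : numClosedFieldType.
Local Notation R := (creal C).
Variable (a : R) (g : C).
Hypotheses (a0 : 0 < a) (a1 : a < 1) (g1 : sq g <= 1) (ag : 1 <= sq (rval a - g)).
Implicit Types (c : C) (e t x : R).

(** This is [Re (1 / (a - g)) >= a / 2] with denominators cleared. Expanding [|g| <= 1] about [a]
    reduces it to the product of [|a - g|^2 - 1] and [1 - a ^+ 2] being nonnegative. *)
Lemma lune_re : a * sq (rval a - g) <= 2 * re (rval a - g).
Proof.
rewrite -(ler_pM2l a0).
have : 0 <= (sq (rval a - g) - 1) * (1 - a ^+ 2).
  by rewrite mulr_ge0 ?subr_ge0 // exprn_ile1 // ltW.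
move: g1; rewrite /sq !coordE; lra.
Qed.

Lemma lune_left t : 0 <= t <= a ->
  apollonius (rval (a - t)) (rval a) (1 - t * (a - t) / 2) g.
Proof.
move=> /andP[t0 ta]; rewrite /apollonius rmorphB.
have h := lune_re; have ag' := ag.
have -> : sq (rval a - rval t - g) = sq (rval a - g) - 2 * t * re (rval a - g) + t ^+ 2.
  by rewrite /sq !coordE; ring.
set M := sq _ in h ag' *; set X := re _ in h *.
have : 0 <= t * (2 * X - a * M) by rewrite mulr_ge0 ?subr_ge0.
have : 0 <= t ^+ 2 * (M - 1) by rewrite mulr_ge0 ?sqr_ge0 ?subr_ge0.
have : 0 <= (t * (a - t)) ^+ 2 * M by rewrite mulr_ge0 ?sqr_ge0 //; lra.
lra.
Qed.

Lemma lune_growth e : 0 <= e ->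
  (1 + e * a) * sq (rval a - g) <= sq (rval (a + e) - g).
Proof.
move=> e0; rewrite rmorphD.
have h := lune_re; have ag' := ag.
have -> : sq (rval a + rval e - g) = sq (rval a - g) + 2 * e * re (rval a - g) + e ^+ 2.
  by rewrite /sq !coordE; ring.
set M := sq _ in h *; set X := re _ in h *.
have : 0 <= e * (2 * X - a * M) by rewrite mulr_ge0 ?subr_ge0.
have := sqr_ge0 e; lra.
Qed.

Lemma lune_right e : 0 <= e -> e * a <= 1 ->
  apollonius (rval a) (rval (a + e)) (1 - e * a / 4) g.
Proof.
move=> e0 ea; have h := lune_growth e0; have ag' := ag; rewrite /apollonius.
have ea0 : 0 <= e * a by rewrite mulr_ge0 // ltW.
set M := sq (rval a - g) in h ag' *; set N := sq _ in h *.
have h2 : 0 <= (1 - e * a / 4) ^+ 2 * (N - (1 + e * a) * M).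
  by rewrite mulr_ge0 ?sqr_ge0 ?subr_ge0.
have h3 : 1 <= (1 - e * a / 4) ^+ 2 * (1 + e * a) by nra.
nra.
Qed.

(** Used with [c] a supposed zero of [p]. Moving the center by [t] costs at most half of the gain
    [e * a * |a - g|^2], and the term [|e + t|^2] at most a quarter. *)
Lemma lune_near e c : 0 < e <= a / 8 -> sq (rval (a - e) - c) <= (a * e / 4) ^+ 2 ->
  apollonius c (rval a) (1 - e * a / 8) g.
Proof.
move=> /andP[e0 ea]; set t := rval (a - e) - c => ht; rewrite /apollonius.
have h := lune_re; have ag' := ag.
have -> : c = rval a - (rval e + t) by rewrite /t rmorphB; ring.
set l := a * e / 4 in ht.
have l0 : 0 < l by rewrite /l; nra.
have tl : nrm t <= l by rewrite nrm_le // ltW.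
have st : sq (rval e + t) <= (e + l) ^+ 2.
  rewrite -nrm_le; last by lra.
  apply: le_trans (nrmD _ _) _; rewrite lerD //.
  by rewrite nrm_le ?(ltW e0) // /sq re_rval im_rval; lra.
have -> : sq (rval a - (rval e + t) - g) = sq (rval a - g)
    - 2 * e * re (rval a - g) - 2 * re (t * (rval a - g)^*) + sq (rval e + t).
  by rewrite /sq !coordE; ring.
have ht' : - (2 * re (t * (rval a - g)^*)) <= 2 * l * sq (rval a - g).
  have : 0 <= l^-1 * sq (t + rval l * (rval a - g)).
    by rewrite mulr_ge0 ?invr_ge0 ?sq_ge0 // ltW.
  have -> : sq (t + rval l * (rval a - g)) =
     sq t + 2 * l * re (t * (rval a - g)^*) + l ^+ 2 * sq (rval a - g).
    by rewrite /sq !coordE; ring.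
  have -> : l^-1 * (sq t + 2 * l * re (t * (rval a - g)^*) + l ^+ 2 * sq (rval a - g))
    = sq t / l + 2 * re (t * (rval a - g)^*) + l * sq (rval a - g).
    by field; rewrite gt_eqF.
  have : sq t / l <= l by rewrite ler_pdivrMr // -expr2.
  have : l * 1 <= l * sq (rval a - g) by rewrite ler_wpM2l // ltW.
  lra.
set M := sq (rval a - g) in h ag' ht' *; set X := re (rval a - g) in h *.
set Y := re _ in ht' *.
have h1 : 0 <= e * (2 * X - a * M) by rewrite mulr_ge0 ?subr_ge0 // ltW.
have h2 : (e + l) ^+ 2 <= e * a / 4.
  have -> : (e + l) ^+ 2 = e * (e * (1 + a / 4) ^+ 2) by rewrite /l; ring.
  have hq : (1 + a / 4) ^+ 2 <= 2.
    have : a ^+ 2 <= 1 by rewrite exprn_ile1 // ltW.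
    by move: a1; lra.
  have : e * (1 + a / 4) ^+ 2 <= a / 8 * 2 by rewrite ler_pM ?sqr_ge0 // ltW.
  by rewrite -(ler_pM2l e0); lra.
have h3 : e * a / 4 * 1 <= e * a / 4 * M by rewrite ler_wpM2l //; nra.
have h4 : 0 <= (e * a / 8) ^+ 2 * M by rewrite mulr_ge0 ?sqr_ge0 //; lra.
rewrite /l in ht'; lra.
Qed.

End Lune.

Section Star.
Variable C : numClosedFieldType.
Local Notation R := (creal C).
Implicit Types (z : C) (x c s y : R).

Lemma sq_rval x : sq (rval x : C) = x ^+ 2.
Proof. by rewrite /sq re_rval im_rval expr0n addr0. Qed.

Lemma sq_star z x :
  sq (1 - z^* * rval x) = sq (rval x - z) + (1 - x ^+ 2) * (1 - sq z).
Proof. by rewrite /sq !coordE; ring. Qed.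

Lemma sq_star_ge z x : sq z <= 1 -> 0 <= x <= 1 ->
  sq (rval x - z) <= sq (1 - z^* * rval x).
Proof.
by move=> z1 /andP[x0 x1]; rewrite sq_star lerDl mulr_ge0 ?subr_ge0 ?exprn_ile1.
Qed.

(** The product of the two factors is [(1 - z^* * c) ^+ 2] minus [(z^* * s) ^+ 2], and
    [|1 - z^* * c| >= 1 - a]; this is the quantitative form of the harmonicity of [log |q|]. *)
Lemma sq_star_mid z (a : R) c s y : sq z <= 1 -> 0 <= c <= a -> a < 1 ->
  s ^+ 2 <= y * (1 - a) ^+ 2 -> 0 <= y ->
  sq (1 - z^* * rval (c + s)) * sq (1 - z^* * rval (c - s)) <=
  sq (1 - z^* * rval c) ^+ 2 * (1 + y) ^+ 2.
Proof.
move=> z1 /andP[c0 ca] a1 sy y0; rewrite -sqM.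
have -> : (1 - z^* * rval (c + s)) * (1 - z^* * rval (c - s)) =
   (1 - z^* * rval c) ^+ 2 - (z^* * rval s) ^+ 2 by rewrite rmorphD rmorphB; ring.
have zn : nrm z <= 1 by rewrite nrm_le // expr1n.
have cn : nrm z^* = nrm z by apply: rval_inj; rewrite !rval_nrm norm_conjC.
have rn x : 0 <= x -> nrm (rval x : C) = x.
  by move=> x0; apply: rval_inj; rewrite rval_nrm ger0_norm // -(rmorph0 (@rval C)) ler_rval.
rewrite -exprMn -nrm_le; last by rewrite mulr_ge0 ?sq_ge0 //; lra.
apply: le_trans (nrmD _ _) _; rewrite nrmN !nrmX -sqE mulrDr mulr1 lerD2l.
rewrite nrmM cn exprMn.
have -> : nrm (rval s : C) ^+ 2 = s ^+ 2 by rewrite -sqE sq_rval.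
have : (1 - a) ^+ 2 <= sq (1 - z^* * rval c).
  rewrite sqE lerXn2r // ?nnegrE ?nrm_ge0 ?subr_ge0 // ?(ltW a1) //.
  have := nrmD (1 - z^* * rval c) (z^* * rval c); rewrite subrK nrm1 nrmM cn rn //.
  have := nrm_ge0 z; nra.
move: (sq _) => Q hQ.
have z2 : nrm z ^+ 2 <= 1 by rewrite exprn_ile1 ?nrm_ge0.
have := sqr_ge0 s; have := sqr_ge0 (nrm z); nra.
Qed.

Lemma sq_star_ratio z (a : R) c (T k : nat) : sq z <= 1 -> 0 <= c <= a -> a < 1 ->
  2 <= T%:R * (1 - a) -> (8 <= k)%N -> 4 <= 2 ^+ k * sq (rval c - z) ->
  sq (1 - z^* * rval c) <=
  sq (rval c - z) * (Num.max (nrm z) (1 / 2))^-1 ^+ (T * k).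
Proof.
move=> z1 /andP[c0 ca] a1 hT hk hQ.
have N0 := nrm_ge0 z; have zn : nrm z <= 1 by rewrite nrm_le // expr1n.
rewrite sq_star (sqE z); set N := nrm z in N0 zn *.
set Q := sq _ in hQ *; have Q0 : 0 <= Q by exact: sq_ge0.
(* Away from the unit circle the power alone exceeds [2 ^+ k]. Near it, [c] is far from [z], and
   Bernoulli's inequality absorbs the excess given by [sq_star]. *)
have [Nr|Nr] := lerP N ((1 + a) / 2).
- have M0 : 0 < Num.max N (1 / 2) by rewrite lt_max; apply/orP; right; lra.
  have Mr : Num.max N (1 / 2) <= (1 + a) / 2 by rewrite ge_max Nr; lra.
  have h : 1 + (1 - a) / 2 <= (Num.max N (1 / 2))^-1.
    by rewrite -[leRHS]mul1r ler_pdivlMr //; nra.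
  have h2 : 2 <= (Num.max N (1 / 2))^-1 ^+ T.
    have b : 1 + T%:R * ((1 - a) / 2) <= (1 + (1 - a) / 2) ^+ T.
      by apply: bernoulli; lra.
    apply: (@le_trans _ _ ((1 + (1 - a) / 2) ^+ T)); first lra.
    by rewrite lerXn2r // nnegrE ?invr_ge0 ?(ltW M0) //; lra.
  have h3 : 2 ^+ k <= (Num.max N (1 / 2))^-1 ^+ (T * k).
    by rewrite exprM lerXn2r // nnegrE //; lra.
  have h4 : Q + (1 - c ^+ 2) * (1 - N ^+ 2) <= 4.
    rewrite /Q /N -sqE -sq_star.
    rewrite -(_ : 2 ^+ 2 = 4 :> R); last by ring.
    rewrite -nrm_le //; apply: le_trans (nrmD _ _) _.
    rewrite nrmN nrm1 nrmM.
    have -> : nrm z^* = nrm z by apply: rval_inj; rewrite !rval_nrm norm_conjC.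
    have : nrm (rval c : C) <= 1 by rewrite nrm_le // sq_rval; nra.
    have := nrm_ge0 (rval c : C); rewrite -/N; nra.
  apply: (le_trans h4); apply: (le_trans hQ); rewrite mulrC ler_wpM2l //.
- have Np : 0 < N by lra.
  have -> : Num.max N (1 / 2) = N by apply/max_idPl; lra.
  have E16 : 16 <= (T * k)%:R * (1 - a).
    have k8 : 8 <= k%:R :> R by rewrite (ler_nat R 8 k).
    rewrite natrM; nra.
  set E := (T * k)%N in E16 *.
  have h1 : 1 + E%:R * (1 - N) <= N^-1 ^+ E.
    apply: (@le_trans _ _ ((1 + (1 - N)) ^+ E)); first by apply: bernoulli; lra.
    rewrite lerXn2r // ?nnegrE ?invr_ge0 //; first lra.
    rewrite -[leRHS]mul1r ler_pdivlMr //; have := sqr_ge0 (1 - N); lra.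
  have hQ2 : ((1 - c) / 2) ^+ 2 <= Q.
    rewrite /Q sqE lerXn2r // ?nnegrE ?nrm_ge0 //; first lra.
    have := nrmD (z - rval c) (rval c); rewrite subrK -/N.
    have : nrm (rval c : C) <= c by rewrite nrm_le // sq_rval.
    have -> : nrm (z - rval c) = nrm (rval c - z) by rewrite -nrmN opprB.
    lra.
  have h5 : 4 * (1 - c) <= Q * E%:R.
    have : ((1 - c) / 2) ^+ 2 * E%:R <= Q * E%:R by rewrite ler_wpM2r.
    have : 16 <= E%:R * (1 - c).
      by apply: (le_trans E16); rewrite ler_wpM2l //; lra.
    nra.
  have h6 : (1 - c ^+ 2) * (1 - N ^+ 2) <= Q * E%:R * (1 - N).
    have -> : (1 - c ^+ 2) * (1 - N ^+ 2) = ((1 - c) * ((1 + c) * (1 + N))) * (1 - N) by ring.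
    rewrite ler_wpM2r ?subr_ge0 //; apply: le_trans h5; rewrite mulrC.
    rewrite ler_wpM2r; [by []|lra|nra].
  apply: (@le_trans _ _ (Q * (1 + E%:R * (1 - N)))); first by lra.
  by rewrite ler_wpM2l.
Qed.

End Star.

(** * The contradiction *)

Lemma ler_prod_in (R : realFieldType) (I : eqType) (r : seq I) (F G : I -> R) :
  {in r, forall i, 0 <= F i <= G i} ->
  \prod_(i <- r) F i <= \prod_(i <- r) G i.
Proof. by move=> h; rewrite big_seq [leRHS]big_seq; apply: ler_prod. Qed.

Lemma prod_mulr_const (R : comNzRingType) (I : Type) (r : seq I) (F : I -> R) (c : R) :
  \prod_(i <- r) (F i * c) = (\prod_(i <- r) F i) * c ^+ size r.
Proof. by rewrite big_split /= big_const_seq count_predT iter_mulr_1. Qed.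

Section Contradiction.
Variable C : numClosedFieldType.
Local Notation R := (creal C).
Variables (a : R) (zs s : seq C).
Local Notation A := (rval a).
Local Notation n := (size s).+1.
Local Notation p := (\prod_(g <- zs) ('X - g%:P)).
Hypotheses (a0 : 0 < a) (a1 : a < 1).
Hypothesis zs1 : {in zs, forall z, sq z <= 1}.
Hypothesis s1 : {in s, forall g, sq g <= 1}.
Hypothesis sa : {in s, forall g, 1 <= sq (A - g)}.
Hypothesis size_zs : size zs = size s.
Hypothesis ds : (('X - A%:P) * p)^`() = n%:R *: \prod_(g <- s) ('X - g%:P).

(** This is [L ^ 2], that is [|P' a / n|^2]; [star] below is [|q|^2]. *)
Let lam : R := \prod_(g <- s) sq (A - g).
Let star (x : R) : R := \prod_(z <- zs) sq (1 - z^* * rval x).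

Let lam_ge1 : 1 <= lam.
Proof.
rewrite -[1](_ : \prod_(g <- s) (1 : R) = 1); last by rewrite big1.
by apply: ler_prod_in => g /sa ->; rewrite ler01.
Qed.

Let sq_p (c : C) : sq p.[c] = \prod_(z <- zs) sq (c - z).
Proof.
by rewrite horner_prod sq_prod; apply: eq_bigr => g _; rewrite hornerXsubC.
Qed.

Lemma sq_p_ge (c : C) x : c != A -> 0 < x <= 1 -> 1 <= n%:R * x ->
  all (apollonius c A (1 - x)) s -> lam / 16 <= sq p.[c].
Proof.
move=> cA x01 nx Ds; have [u ux ->] := value_left ds cA x01 Ds.
have := sq_geom_ge x01 nx ux; rewrite sqM sq_prod -/lam.
have := lam_ge1; move: (sq _) => G; nra.
Qed.

Lemma sq_p_le (c : C) x : c != A -> 0 < x <= 1 ->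
  all (apollonius c A (1 - x)) s -> sq p.[c] <= lam * (2 / x) ^+ 2.
Proof.
move=> cA x01 Ds; have [u ux ->] := value_left ds cA x01 Ds.
rewrite sqM sq_prod -/lam ler_wpM2l ?sq_geom_le //.
by have := lam_ge1; lra.
Qed.

Lemma all_left t : 0 <= t <= a ->
  all (apollonius (rval (a - t)) A (1 - t * (a - t) / 2)) s.
Proof.
by move=> ta; apply/allP => g gs; apply: lune_left => //; first [exact: s1|exact: sa].
Qed.

Lemma left_neq t : 0 < t -> rval (a - t) != A.
Proof. by move=> t0; rewrite (inj_eq (@rval_inj C)); lra. Qed.

Lemma sq_p_left_ge t : 0 < t < a -> 1 <= n%:R * (t * (a - t) / 2) ->
  lam / 16 <= sq p.[rval (a - t)].
Proof.
move=> /andP[t0 ta] nt; apply: sq_p_ge nt (all_left _); rewrite ?left_neq //; last by lra.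
have := a1; nra.
Qed.

Lemma sq_p_right_ge e : 0 < e -> e * a <= 1 -> 1 <= n%:R * (e * a / 4) ->
  lam * (1 + e * a) ^+ size s / 16 <= sq p.[rval (a + e)].
Proof.
move=> e0 ea nt.
have x01 : 0 < e * a / 4 <= 1 by have := mulr_gt0 e0 a0; lra.
have Ds : all (apollonius A (rval (a + e)) (1 - e * a / 4)) s.
  apply/allP => g gs; apply: lune_right => //; first [exact: s1|exact: sa|exact: ltW].
have Ae : A != rval (a + e) by rewrite (inj_eq (@rval_inj C)); lra.
have [u ux ->] := value_right ds Ae x01 Ds.
rewrite sqM sq_prod.
have h : lam * (1 + e * a) ^+ size s <= \prod_(g <- s) sq (rval (a + e) - g).
  rewrite -prod_mulr_const; apply: ler_prod_in => g gs.
  apply/andP; split.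
    by rewrite mulr_ge0 ?sq_ge0 //; have := mulr_gt0 e0 a0; lra.
  rewrite mulrC; apply: lune_growth => //; first [exact: s1|exact: sa|exact: ltW].
rewrite ler_pM ?invr_ge0 //.
  rewrite mulr_ge0 ?exprn_ge0 //; first by have := lam_ge1; lra.
  by have := mulr_gt0 e0 a0; lra.
by have := sq_geom_ge x01 nt ux; rewrite mul1r.
Qed.

(** At a zero [z] of [p] this close to [a - e], [lune_near] would make [sq_p_ge] apply with value
    0. *)
Lemma root_far e : 0 < e <= a / 8 -> 1 <= n%:R * (e * a / 8) ->
  {in zs, forall z, (a * e / 4) ^+ 2 <= sq (rval (a - e) - z)}.
Proof.
move=> /andP[e0 ea] ne z zz; rewrite leNgt; apply/negP => /ltW near.
have ea0 := mulr_gt0 e0 a0.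
have ea1 : e * a <= 1 by have := a1; nra.
have zA : z != A.
  apply: contraTneq near => ->.
  rewrite -rmorphB sq_rval -ltNge (_ : a - e - a = - e); last by ring.
  by rewrite sqrrN ltrXn2r // ?nnegrE; have := a1; nra.
have := @sq_p_ge z (e * a / 8) zA _ ne.
have -> : sq p.[z] = 0.
  apply/eqP; rewrite sq_eq0; apply/eqP/rootP.
  by rewrite root_prod_XsubC.
move=> H; suff : lam / 16 <= 0 by have := lam_ge1; lra.
apply: H; first by lra.
apply/allP => g gs; apply: lune_near => //; first [exact: s1|exact: sa|by rewrite e0].
Qed.

Let M (z : C) : R := Num.max (nrm z) (1 / 2).
Let W : R := \prod_(z <- zs) (M z)^-1.

Let M_gt0 z : 0 < M z. Proof. by rewrite lt_max divr_gt0 ?orbT. Qed.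

(** The lower bound for [p] at [c0] gives [1 / 4 <= prod |c0 - z|]. Each factor is at most
    [M z * (1 + 2 * c0)] because [M z >= 1 / 2], and the powers of [1 + 2 * c0] stay below
    [4 ^+ K]. *)
Lemma W_le (K : nat) : 8 <= n%:R * a ^+ 2 -> 8 <= K%:R * a -> W <= 4 ^+ K.+1.
Proof.
move=> hn hK; have n0 : 0 < n%:R :> R by rewrite ltr0n.
(* The 4 is what [sq_p_left_ge] needs at [t = a - c0], where [t >= a / 2]. *)
pose c0 := 4 / (n%:R * a).
have na0 : 0 < n%:R * a by rewrite mulr_gt0.
have c00 : 0 < c0 by rewrite divr_gt0.
have c0n : n%:R * a * c0 = 4 by rewrite /c0 mulrC divfK // gt_eqF.
have c0a : c0 <= a / 2 by rewrite ler_pdivrMr //; lra.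
have h1 : 1 / 16 <= sq p.[rval c0].
  have -> : c0 = a - (a - c0) by ring.
  apply: (@le_trans _ _ (lam / 16)); first by have := lam_ge1; lra.
  apply: sq_p_left_ge; first by lra.
  have -> : a - (a - c0) = c0 by ring.
  have := mulr_gt0 n0 c00 => nc0.
  have : 0 <= n%:R * c0 * (a / 2 - c0) by rewrite mulr_ge0 ?subr_ge0 // ltW.
  lra.
have h2 : 1 / 4 <= \prod_(z <- zs) nrm (rval c0 - z).
  move: h1; rewrite sq_p; under eq_bigr do rewrite sqE; rewrite prodrXl.
  have : 0 <= \prod_(z <- zs) nrm (rval c0 - z) by rewrite prodr_ge0 // => z _; exact: nrm_ge0.
  move: (\prod_(z <- zs) _) => X X0 hX; rewrite leNgt; apply/negP => X4; nra.
have h3 : \prod_(z <- zs) nrm (rval c0 - z) <= (\prod_(z <- zs) M z) * (1 + 2 * c0) ^+ size zs.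
  rewrite -prod_mulr_const; apply: ler_prod_in => z _; rewrite nrm_ge0 /=.
  apply: le_trans (nrmD _ _) _; rewrite nrmN.
  have : nrm (rval c0 : C) <= c0 by rewrite nrm_le ?sq_rval // ltW.
  have : nrm z <= M z by rewrite le_max lexx.
  have : 1 / 2 <= M z by rewrite le_max lexx orbT.
  nra.
have WM : W * (\prod_(z <- zs) M z) = 1.
  by rewrite /W -big_split big1 //= => z _; rewrite mulVf // gt_eqF.
have h4 : (1 + 2 * c0) ^+ size zs <= 4 ^+ K.
  have h5 : 1 + 2 * c0 <= (1 + n%:R^-1) ^+ K.
    apply: le_trans (bernoulli _ _); last by rewrite invr_ge0 ltW.
    rewrite lerD2l ler_pdivlMr //.
    by rewrite -(ler_pM2r a0); lra.
  apply: (@le_trans _ _ (((1 + n%:R^-1) ^+ n) ^+ K)); last first.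
    by rewrite lerXn2r ?nnegrE // ?expr_1DV_le4 // exprn_ge0 // addr_ge0 // invr_ge0 ltW.
  rewrite exprAC size_zs.
  have c1 : 1 <= 1 + 2 * c0 by lra.
  apply: (@le_trans _ _ ((1 + 2 * c0) ^+ n)); first by rewrite ler_weXn2l.
  by rewrite lerXn2r // nnegrE ?exprn_ge0 //; [lra|rewrite addr_ge0 // invr_ge0 ltW].
have W0 : 0 <= W by rewrite prodr_ge0 // => z _; rewrite invr_ge0 ltW.
have P0 : 0 <= \prod_(z <- zs) M z by rewrite prodr_ge0 // => z _; rewrite ltW.
have h6 : 1 / 4 <= (\prod_(z <- zs) M z) * 4 ^+ K.
  by apply: (le_trans h2); apply: (le_trans h3); rewrite ler_wpM2l.
have : W * (1 / 4) <= W * ((\prod_(z <- zs) M z) * 4 ^+ K) by rewrite ler_wpM2l.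
rewrite mulrA WM exprS; lra.
Qed.

Lemma star_ge x : 0 <= x <= 1 -> sq p.[rval x] <= star x.
Proof.
move=> x01; rewrite sq_p; apply: ler_prod_in => z zz.
by rewrite sq_ge0 sq_star_ge // zs1.
Qed.

Lemma star_mid c t y : 0 <= c <= a -> t ^+ 2 <= y * (1 - a) ^+ 2 -> 0 <= y ->
  star (c + t) * star (c - t) <= star c ^+ 2 * ((1 + y) ^+ 2) ^+ size s.
Proof.
move=> ca ty y0; rewrite /star -big_split /= -prodrXl -size_zs -prod_mulr_const.
apply: ler_prod_in => z zz; rewrite mulr_ge0 ?sq_ge0 //=.
exact: (sq_star_mid (zs1 zz) ca a1).
Qed.

Lemma star_le c (T k : nat) : 0 <= c <= a -> 2 <= T%:R * (1 - a) -> (8 <= k)%N ->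
  {in zs, forall z, 4 <= 2 ^+ k * sq (rval c - z)} ->
  star c <= sq p.[rval c] * W ^+ (T * k).
Proof.
move=> ca hT hk far; rewrite sq_p /W -prodrXl -big_split /=.
apply: ler_prod_in => z zz; rewrite sq_ge0 /=.
exact: (sq_star_ratio (zs1 zz) ca a1 hT hk (far z zz)).
Qed.

Lemma no_far_critical_points : 144 ^+ 2 <= a ^+ 7 * (1 - a) ^+ 4 * n%:R -> False.
Proof.
move=> hn; have a01 : 0 < a < 1 by rewrite a0.
have [K [T [k [J [hK hT [hk hV] hJ hm]]]]] := parameters a01 hn.
have n0 : 0 < n%:R :> R by rewrite ltr0n.
have [] := step_bounds a0 a1; have := step_large a0 a1 n0 hn.
have := step_sqr a0 a1 hV.
have : 3 / 2 * (a * (1 - a) ^+ 2 / 9 * a / 4) = (a * (1 - a)) ^+ 2 / 24 by field.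
(* This identity fixes [e]: with spacing [3 * e / 2], the loss in [star_mid] is exactly
   [y = e * a / 4]. *)
have : (3 * (a * (1 - a) ^+ 2 / 9) / 2) ^+ 2 =
  a * (1 - a) ^+ 2 / 9 * a / 4 * (1 - a) ^+ 2 by field.
set e := a * _ / 9 => tE dE V nea e0 ea9 eb9 ea1.
have e9 : 0 < e <= a / 9 by rewrite e0.
have ea0 : 0 < e * a by rewrite mulr_gt0.
have na2 : 8 <= n%:R * a ^+ 2.
  apply: le_trans (_ : n%:R * (e * a) <= _); first by move: nea; lra.
  by rewrite ler_pM2l // expr2 ler_pM2r //; move: ea9 a0; lra.
have hd : lam * (1 + e * a) ^+ size s / 16 <= star (a + e).
  apply: le_trans (star_ge _); last by move: eb9 a0 e0; lra.
  by apply: sq_p_right_ge => //; move: nea ea1; lra.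
have hc2 : lam / 16 <= star (a - 2 * e).
  apply: le_trans (star_ge _); last by move: ea9 a1 e0; lra.
  by apply: sq_p_left_ge (left_mass n0 e9 nea); move: ea9 e0; lra.
have hfar : {in zs, forall z, 4 <= 2 ^+ k * sq (rval (a - e / 2) - z)}.
  move=> z zz; apply: (far_scale e0 a0 V); apply: (root_far _ _ zz).
    by move: e0 ea9; lra.
  by move: nea; lra.
have ca : 0 <= a - e / 2 <= a by move: e0 ea9; lra.
have [x0 x1 x2] := left_scale e9 a1.
have lam0 : 0 < lam := lt_le_trans ltr01 lam_ge1.
have W0 : 0 <= W by rewrite prodr_ge0 // => z _; rewrite invr_ge0 ltW.
have hc1 : star (a - e / 2) <= lam * 2 ^+ k * W ^+ (T * k).
  apply: le_trans (star_le ca hT hk hfar) _.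
  rewrite ler_wpM2r ?exprn_ge0 //.
  apply: le_trans (_ : lam * (2 / (e / 2 * (a - e / 2) / 2)) ^+ 2 <= _).
    have e2 : 0 < e / 2 by rewrite divr_gt0.
    have x01 : 0 < e / 2 * (a - e / 2) / 2 <= 1 by rewrite x0.
    apply: (sq_p_le (left_neq e2) x01 (all_left _)).
    by move: e0 ea9; lra.
  by rewrite ler_wpM2l ?(ltW lam0) // (le_trans x2).
pose y := e * a / 4.
have y0 : 0 <= y <= 1 / 36 by rewrite /y; move: ea0 ea1; lra.
have y4 : e * a = 4 * y by rewrite /y; field.
have hmid : star (a + e) * star (a - 2 * e) <=
    star (a - e / 2) ^+ 2 * ((1 + y) ^+ 2) ^+ size s.
  rewrite (_ : a + e = a - e / 2 + 3 * e / 2); last by field.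
  rewrite (_ : a - 2 * e = a - e / 2 - 3 * e / 2); last by field.
  apply: star_mid ca _ _; last by case/andP: y0.
  by rewrite tE.
rewrite y4 in hd.
have s0 : 0 <= star (a - e / 2) by rewrite prodr_ge0 // => z _; exact: sq_ge0.
have s1' : 0 <= star (a - e / 2) <= lam * 2 ^+ k * W ^+ (T * k) by rewrite s0.
have gap : (1 + 3 / 2 * y) ^+ size s <= 256 * (2 ^+ k * W ^+ (T * k)) ^+ 2.
  apply: (growth_gap lam0 _ _ y0 hd hc2 s1' hmid); first exact: exprn_ge0.
  exact: exprn_ge0.
apply/negP: gap; rewrite -ltNge.
apply: (exponent_gap _ _ _ hm).
- by case/andP: y0 => yy _; rewrite mulr_ge0 // divr_ge0.
- by rewrite dE mulrA ler_pdivlMr // mul1r.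
- by rewrite exprn_ge0 //= lerXn2r ?nnegrE ?exprn_ge0 // W_le.
Qed.

End Contradiction.


(** * From a polynomial to its list of critical points *)

Lemma deriv_monic_factor (C : numClosedFieldType) (P : {poly C}) m :
  P \is monic -> size P = m.+2 ->
  exists2 s, size s = m & P^`() = m.+1%:R *: \prod_(g <- s) ('X - g%:P).
Proof.
move=> /monicP lP sP.
have cm : P^`()`_m = m.+1%:R by rewrite coef_deriv -[in RHS]lP /lead_coef sP.
have sd : size P^`() = m.+1.
  apply/eqP; rewrite eqn_leq; apply/andP; split.
    by rewrite -ltnS -sP lt_size_deriv // -size_poly_eq0 sP.
  rewrite ltnNge; apply: contraNN (_ : P^`()`_m != 0); last by rewrite cm pnatr_eq0.
  by move=> h; rewrite nth_default.
have [s Es] := closed_field_poly_normal P^`().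
have lE : lead_coef P^`() = m.+1%:R by rewrite /lead_coef sd.
exists s; last by rewrite {1}Es lE.
by apply: eq_add_S; rewrite -sd Es size_scale ?lE ?pnatr_eq0 // size_prod_XsubC.
Qed.

Theorem mainTheorem1 (C : numClosedFieldType) (a : C)
  (ha_real : a \is Num.real) (ha0 : 0 < a) (ha1 : a < 1)
  (n : nat) (hn : calN a <= n%:R)
  (z : 'I_n.-1 -> C) (hz : forall j, `|z j| <= 1) :
  exists w : C, root (sendovP a z)^`() w /\ `|w - a| <= 1.
Proof.
pose b : creal C := Sub a ha_real.
have aE : a = rval b by [].
have b0 : 0 < b by [].
have b1 : b < 1 by [].
pose zs := [seq z j | j <- enum 'I_n.-1].
have PE : sendovP a z = ('X - (rval b)%:P) * \prod_(g <- zs) ('X - g%:P).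
  by rewrite /sendovP /zs big_map big_enum.
have sz : size zs = n.-1 by rewrite size_map size_enum_ord.
have nrm_le1 (x : C) : (`|x| <= 1) = (sq x <= 1).
  by rewrite -[X in sq x <= X](expr1n _ 2) -nrm_le // -ler_rval rmorph1.
have zs1 : {in zs, forall g, sq g <= 1}.
  by move=> g /mapP[j _ ->]; rewrite -nrm_le1.
have PE' : sendovP a z = \prod_(g <- a :: zs) ('X - g%:P) by rewrite PE big_cons.
have [s ss dP] : exists2 s, size s = n.-1 &
    (sendovP a z)^`() = n.-1.+1%:R *: \prod_(g <- s) ('X - g%:P).
  apply: deriv_monic_factor; first by rewrite PE' monic_prod_XsubC.
  by rewrite PE' size_prod_XsubC /= sz.
have rootE w : root (sendovP a z)^`() w = (w \in s).
  by rewrite dP rootZ ?pnatr_eq0 // root_prod_XsubC.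
have [/hasP[w ws wa]|/hasPn far] := boolP (has (fun w => `|w - a| <= 1) s).
  by exists w; rewrite rootE.
exfalso; apply: (@no_far_critical_points C b zs s) => //.
- move=> g gs; apply: (@gauss_lucas C (a :: zs)) => //; last by rewrite -PE' rootE.
  move=> x; rewrite inE => /orP[/eqP ->|/zs1 //].
  by rewrite -nrm_le1 ger0_norm ltW.
- by move=> g /far; rewrite nrm_le1 -ltNge sqC => /ltW.
- by rewrite sz ss.
- by rewrite -PE dP ss.
(* As [calN a] is positive, [n = 0] is excluded, for which [n.-1.+1] would not be [n]. *)
have n0 : (0 < n)%N.
  rewrite lt0n; apply: contraTneq hn => ->; rewrite lt_geF //.
  by rewrite divr_gt0 ?ltr0n // mulr_gt0 ?exprn_gt0 ?subr_gt0.
have lE : rval (144 ^+ 2 : creal C) = 144 ^+ 2 by rewrite rmorphXn /= rmorph_nat.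
have rE : rval (b ^+ 7 * (1 - b) ^+ 4 * n%:R) = a ^+ 7 * (1 - a) ^+ 4 * n%:R.
  by rewrite rmorphM rmorphM !rmorphXn rmorphB rmorph1 rmorph_nat.
rewrite ss prednK // -ler_rval lE rE.
have ab0 : 0 < a ^+ 7 * (1 - a) ^+ 4 by rewrite mulr_gt0 ?exprn_gt0 ?subr_gt0.
move: hn; rewrite /calN ler_pdivrMr // [leRHS]mulrC; apply: le_trans.
(* The comparison is [144 ^ 2 = 20736 <= 20800]. *)
by rewrite -natrX ler_nat; vm_compute.
Qed.
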